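(* Let $A\subseteq\mathbb{N}$. (1) For all non-principal ultrafilters $\mathcal{U}$ and $\mathcal{V}$ on $\mathbb{N}$, one has $$(\mathcal{U}\otimes\mathcal{V})\text{-}\lim_{(n,m)}\left[\max_{1\le k\le n}\left(\min_{1\le x\le m}\frac{|A\cap[x+1,x+k]|}{k}\right)\right]=\underline{\mathrm{BD}}(A).$$ (2) For all non-principal ultrafilters $\mathcal{U}$ and $\mathcal{V}$ on $\mathbb{N}$, one has $$(\mathcal{U}\otimes\mathcal{V})\text{-}\lim_{(n,m)}\left[\min_{1\le k\le n}\left(\max_{1\le x\le m}\frac{|A\cap[x+1,x+k]|}{k}\right)\right]=\overline{\mathrm{BD}}(A).$$
   Context: $\mathbb{N}=\{1,2,3,\ldots\}$. The lower and upper Banach density of $A\subseteq\mathbb{N}$ are $$\underline{\mathrm{BD}}(A)=\lim_{n\to\infty}\left(\min_{x\in\mathbb{N}}\frac{|A\cap[x+1,x+n]|}{n}\right),\qquad \overline{\mathrm{BD}}(A)=\lim_{n\to\infty}\left(\max_{x\in\mathbb{N}}\frac{|A\cap[x+1,x+n]|}{n}\right);$$ these limits exist. For ultrafilters $\mathcal{U},\mathcal{V}$ on $\mathbb{N}$, the tensor product $\mathcal{U}\otimes\mathcal{V}$ is the ultrafilter on $\mathbb{N}\times\mathbb{N}$ defined by: $X\in\mathcal{U}\otimes\mathcal{V}$ if and only if $\{n\in\mathbb{N}\mid\{m\in\mathbb{N}\mid (n,m)\in X\}\in\mathcal{V}\}\in\mathcal{U}$. For an ultrafilter $\mathcal{W}$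 on a set $I$, a real sequence $(x_i\mid i\in I)$ and $\ell\in\mathbb{R}$, one writes $\mathcal{W}\text{-}\lim_i x_i=\ell$ if $\{i\in I\mid x_i\in U\}\in\mathcal{W}$ for every neighborhood $U$ of $\ell$. *)

(* Defs.v *)
From HB Require Import structures.
From mathcomp Require Import all_boot all_order all_algebra.
From mathcomp Require Import finmap.
From mathcomp Require Import all_classical all_reals all_analysis.
Set Implicit Arguments.
Unset Strict Implicit.
Unset Printing Implicit Defensive.
Import Order.TTheory GRing.Theory Num.Theory.
Import numFieldNormedType.Exports.
Local Open Scope classical_set_scope.
Local Open Scope ring_scope.

(* The natural numbers start at 1. *)
Notation posnat := {n : nat | (0 < n)%N}.

Definition window_card (A : set posnat) (x k : nat) : nat :=
  #|` fset_set (A `&` [set y | (x.+1 <= val y <= x + k)%N]) |%fset.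

Definition window_density (R : realType) (A : set posnat) (x k : nat) : R :=
  (window_card A x k)%:R / k%:R.

(* f 1 serves as the default value of the iterated operator, so that for 0 < n
   these are the minimum and the maximum of f 1, ..., f n. *)
Definition min_upto (R : realType) (f : nat -> R) (n : nat) : R :=
  \big[Num.min/f 1%N]_(1 <= i < n.+1) f i.

Definition max_upto (R : realType) (f : nat -> R) (n : nat) : R :=
  \big[Num.max/f 1%N]_(1 <= i < n.+1) f i.

(* For each n the densities of windows of length n take finitely many values,
   so that the infimum and supremum below are attained
   (min_densityP, max_densityP). *)
Definition min_density (R : realType) (A : set posnat) (n : nat) : R :=
  inf [set window_density R A x n | x in [set x | (0 < x)%N]].

Definition max_density (R : realType) (A : set posnat) (n : nat) : R :=
  sup [set window_density R A x n | x in [set x | (0 < x)%N]].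

Definition lower_BD (R : realType) (A : set posnat) : R :=
  limn (min_density R A).

Definition upper_BD (R : realType) (A : set posnat) : R :=
  limn (max_density R A).

Definition nonprincipal (T : Type) (U : set_system T) : Prop :=
  forall x : T, U <> principal_filter x.

Definition tensor (S T : Type) (U : set_system S) (V : set_system T) :
    set_system (S * T) :=
  [set X | U [set n | V [set m | X (n, m)]]].

Lemma tensor_ultra (S T : Type) (U : set_system S) (V : set_system T) :
  UltraFilter U -> UltraFilter V -> UltraFilter (tensor U V).
Proof.
move=> UU UV; have TP : ProperFilter (tensor U V).
  apply: Build_ProperFilter_ex.
    by move=> X /(@filter_ex _ U)[n /filter_ex[m Xnm]]; exists (n, m).
  split; rewrite /tensor /=.
  - by apply: (@filterE _ U) => n; exact: filterT.
  - by move=> X Y UX UY; apply: (@filterS2 _ U) UX UY => n /=; exact: filterS2.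
  - by move=> X Y XY; apply: (@filterS _ U) => n /=; apply: filterS => m; exact: XY.
split=> // G GP TG; apply/seteqP; split=> // X GX.
have [//|nU] := in_ultra_setVsetC [set n | V [set m | X (n, m)]] UU.
have GnX : G (~` X).
  apply: TG; apply: (@filterS _ U) nU => n /= nV.
  by have [|] := in_ultra_setVsetC [set m | X (n, m)] UV.
by have [p []] := filter_ex (@filterI _ G _ _ _ GX GnX).
Qed.

Lemma window_card_le (A : set posnat) (x k : nat) : (window_card A x k <= k)%N.
Proof.
have wfin : finite_set (A `&` [set y | (x.+1 <= val y <= x + k)%N]).
  apply: (@sub_finite_set _ _ (val @^-1` `I_(x + k).+1)) => [y [_ /andP[]]//|].
  by apply: finite_preimage; [move=> y z _ _; exact: val_inj|exact: finite_II].
rewrite /window_card -(size_map val) -[leqRHS](size_iota x.+1).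
apply: uniq_leq_size; first by rewrite (map_inj_uniq val_inj) fset_uniq.
move=> _ /mapP[y + ->]; rewrite in_fset_set// inE => -[_ /=].
by rewrite mem_iota addSn ltnS.
Qed.

Lemma min_densityP (R : realType) (A : set posnat) (n : nat) :
  exists2 x, (0 < x)%N & min_density R A n = window_density R A x n /\
    forall y, (0 < y)%N -> window_density R A x n <= window_density R A y n.
Proof.
have ex : exists c, `[< exists2 x, (0 < x)%N & window_card A x n = c >].
  by exists (window_card A 1 n); apply/asboolP; exists 1%N.
have [_ /asboolP[x x0 <-] minx] := ex_minnP ex.
have xle y : (0 < y)%N -> window_density R A x n <= window_density R A y n.
  move=> y0; rewrite ler_wpM2r ?invr_ge0// ler_nat; apply: minx.
  by apply/asboolP; exists y.
exists x => //; split=> //; apply/eqP; rewrite eq_le; apply/andP; split.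
  apply: ge_inf; last by exists x.
  by exists (window_density R A x n) => _ [y y0 <-]; exact: xle.
apply: lb_le_inf; first by exists (window_density R A x n), x.
by move=> _ [y y0 <-]; exact: xle.
Qed.

Lemma max_densityP (R : realType) (A : set posnat) (n : nat) :
  exists2 x, (0 < x)%N & max_density R A n = window_density R A x n /\
    forall y, (0 < y)%N -> window_density R A y n <= window_density R A x n.
Proof.
have ex : exists c, `[< exists2 x, (0 < x)%N & window_card A x n = c >].
  by exists (window_card A 1 n); apply/asboolP; exists 1%N.
have bd c : `[< exists2 x, (0 < x)%N & window_card A x n = c >] -> (c <= n)%N.
  by move=> /asboolP[x _ <-]; exact: window_card_le.
have [_ /asboolP[x x0 <-] maxx] := ex_maxnP ex bd.
have xge y : (0 < y)%N -> window_density R A y n <= window_density R A x n.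
  move=> y0; rewrite ler_wpM2r ?invr_ge0// ler_nat; apply: maxx.
  by apply/asboolP; exists y.
exists x => //; split=> //; apply/eqP; rewrite eq_le; apply/andP; split.
  apply: ge_sup; first by exists (window_density R A x n), x.
  by move=> _ [y y0 <-]; exact: xge.
apply: ub_le_sup; last by exists x.
by exists (window_density R A x n) => _ [y y0 <-]; exact: xge.
Qed.

(* Main.v *)
Require Import Defs.
From mathcomp Require Import all_boot all_order all_algebra.
From mathcomp Require Import all_classical all_reals all_analysis.
From mathcomp Require Import finmap zify lra.
Set Implicit Arguments.
Unset Strict Implicit.
Unset Printing Implicit Defensive.
Import Order.TTheory GRing.Theory Num.Theory.
Import numFieldNormedType.Exports.
Local Open Scope classical_set_scope.
Local Open Scope ring_scope.

(** Let [mu k] be the least density of [A] on a window of length [k].  A window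
of length [k + l] splits into one of length [k] and one of length [l], so
[k * mu k] is superadditive, and by Fekete's lemma [mu n] converges to the
supremum of the [mu k] ([superadditive_cvg]).  The running maximum of
[mu 1, ..., mu n] lies between [mu n] and this supremum, hence has the same
limit ([superadditive_max_cvg]); by definition that limit is the lower Banach
density.

The tensor product takes the two limits one after the other.  For a fixed [n],
only finitely many [k <= n] are involved and each [mu k] is attained at some
[x], so as soon as [m] exceeds these [x] the expression is exactly the maximum
of [mu 1, ..., mu n].  A non-principal ultrafilter contains every final segment
of the positive integers, so this happens for almost every [m], and then the
convergence in [n] gives the limit ([tensor_cvg]).

The argument uses the window counts only through their additivity and the bound
by the length of the window.  It therefore applies to the negated counts as
well; negation exchanges minima and maxima, which yields the upper density. *)

(** * Running maxima and minima *)

Lemma max_upto_ge (R : realType) (f : nat -> R) (n k : nat) :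
  (0 < k <= n)%N -> f k <= max_upto f n.
Proof. by move=> kn; apply: le_bigmax_seq => //; rewrite mem_index_iota ltnS. Qed.

Lemma max_upto_le (R : realType) (f : nat -> R) (n : nat) (b : R) :
  (forall k, (0 < k)%N -> f k <= b) -> max_upto f n <= b.
Proof.
move=> fb; rewrite /max_upto big_nat_cond; apply: bigmax_le; first exact: fb.
by move=> k /andP[/andP[k0 _] _]; exact: fb.
Qed.

(** The bound [n.+1], rather than [n], covers the default value [f 1] of an
empty range. *)
Lemma eq_max_upto (R : realType) (f g : nat -> R) (n : nat) :
  (forall k, (k <= n.+1)%N -> f k = g k) -> max_upto f n = max_upto g n.
Proof.
move=> fg; rewrite /max_upto (fg 1%N)//.
by apply: eq_big_nat => k /andP[_ kn]; apply: fg; exact: ltnW.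
Qed.

Lemma max_uptoN (R : realType) (f : nat -> R) (n : nat) :
  max_upto (fun k => - f k) n = - min_upto f n.
Proof.
rewrite /max_upto /min_upto.
by rewrite (big_morph -%R (id1 := - f 1%N) (op1 := Num.max))//; exact: oppr_min.
Qed.

Lemma min_uptoN (R : realType) (f : nat -> R) (n : nat) :
  min_upto (fun k => - f k) n = - max_upto f n.
Proof.
rewrite /max_upto /min_upto.
by rewrite (big_morph -%R (id1 := - f 1%N) (op1 := Num.min))//; exact: oppr_max.
Qed.

(** A running minimum is eventually constant once the global minimum over the
positive integers is attained: this is what makes the inner limit exact. *)
Lemma min_upto_near (R : realType) (f : nat -> R) (x : nat) :
  (0 < x)%N -> (forall y, (0 < y)%N -> f x <= f y) ->
  \forall m \near \oo, min_upto f m = f x.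
Proof.
move=> x0 fx; near=> m; have xm : (x <= m)%N by near: m; exact: nbhs_infty_ge.
apply/eqP; rewrite -eqr_opp -max_uptoN eq_le; apply/andP; split.
  by apply: max_upto_le => y y0; rewrite lerN2 fx.
by apply: (@max_upto_ge _ (fun k => - f k)); rewrite x0.
Unshelve. all: by end_near. Qed.

(** * Fekete's lemma *)

Section superadditive.
Context (R : realType) (a : nat -> R).
Hypothesis aD : forall k l, a k + a l <= a (k + l)%N.
Hypothesis abd : forall n, `|a n| <= n%:R.

Let slopes := [set a k / k%:R | k in [set k | (0 < k)%N]].

Let slope_bound k : `|a k / k%:R| <= 1.
Proof.
have [->|k0] := posnP k; first by rewrite invr0 mulr0 normr0.
by rewrite normrM normfV normr_nat ler_pdivrMr ?ltr0n// mul1r.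
Qed.

Let slopes_sup : has_sup slopes.
Proof.
split; first by exists (a 1 / 1%:R), 1%N.
by exists 1 => _ [k _ <-]; exact: le_trans (ler_norm _) (slope_bound k).
Qed.

Lemma slope_le_sup k : (0 < k)%N -> a k / k%:R <= sup slopes.
Proof. by move=> k0; apply: ub_le_sup; [case: slopes_sup|exists k]. Qed.

Let superadditive_muln q k r : q%:R * a k + a r <= a (q * k + r)%N.
Proof.
elim: q => [|q IHq]; first by rewrite mul0r add0r.
rewrite mulSn -addnA; apply: le_trans (aD _ _).
by rewrite -addn1 natrD mulrDl mul1r addrAC [leRHS]addrC lerD2r.
Qed.

(** Cut [n] into [n %/ k] blocks of length [k].  On the incomplete last block, the
value of [a] and the value that slope [a k / k] predicts are both at most [k] in
absolute value; dividing by [n] gives the error [2 * k / n]. *)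
Let slope_near k n : (0 < k)%N -> (0 < n)%N ->
  a k / k%:R - 2 * k%:R / n%:R <= a n / n%:R.
Proof.
move=> k0 n0; have kR : 0 < k%:R :> R by rewrite ltr0n.
have nR : 0 < n%:R :> R by rewrite ltr0n.
rewrite ler_pdivlMr// mulrBl divfK ?gt_eqF//.
have := superadditive_muln (n %/ k) k (n %% k); rewrite -divn_eq.
have := abd (n %% k); have := slope_bound k.
have -> : a k = a k / k%:R * k%:R by rewrite divfK ?gt_eqF.
have : (n %% k)%:R <= k%:R :> R by rewrite ler_nat ltnW// ltn_mod.
have : 0 <= (n %% k)%:R :> R by [].
have : n%:R = (n %/ k)%:R * k%:R + (n %% k)%:R :> R.
  by rewrite -natrM -natrD -divn_eq.
rewrite !mulfK ?gt_eqF//.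
move: (a k / _) (a (n %% k)) (n %% k)%:R => s t r -> r0 rk.
rewrite !ler_norml => /andP[s0 s1] /andP[t0 _].
by nra.
Qed.

(** Fekete's lemma for a sequence of at most linear growth: a slope [a k / k]
close to the supremum is a lower bound, up to [O(1 / n)], for all [a n / n]. *)
Lemma superadditive_cvg : a n / n%:R @[n --> \oo] --> sup slopes.
Proof.
apply/cvgrPdist_le => e e0.
have e2 : 0 < e / 2 by rewrite divr_gt0.
have [_ [k k0 <-] ske] := sup_adherent e2 slopes_sup.
near=> n; have n0 : (0 < n)%N by near: n; exact: nbhs_infty_gt.
have nR : 0 < n%:R :> R by rewrite ltr0n.
have kne : 2 * k%:R / n%:R <= e / 2.
  rewrite ler_pdivrMr// [leRHS]mulrC -ler_pdivrMr//.
  by near: n; exact: nbhs_infty_ger.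
have := slope_near k0 n0; have := slope_le_sup n0.
move: ske kne; set s := sup _; rewrite ler_norml => *.
by apply/andP; split; lra.
Unshelve. all: by end_near. Qed.

Lemma superadditive_max_cvg :
  max_upto (fun k => a k / k%:R) n @[n --> \oo] --> sup slopes.
Proof.
apply: (squeeze_cvgr _ superadditive_cvg (cvg_cst (sup slopes))).
near=> n; rewrite max_upto_le ?andbT; last by move=> k k0; exact: slope_le_sup.
apply: (@max_upto_ge _ (fun k => a k / k%:R)); rewrite leqnn andbT.
by near: n; exact: nbhs_infty_gt.
Unshelve. all: by end_near. Qed.

End superadditive.

(** * Limits along tensor products *)

(** An ultrafilter that contains a singleton is principal. *)
Lemma nonprincipal_notin (T : Type) (U : set_system T) (x : T) :
  UltraFilter U -> nonprincipal U -> U (~` [set x]).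
Proof.
move=> UU Unp; have [Ux|//] := in_ultra_setVsetC [set x] UU.
exfalso; apply: (Unp x); apply/seteqP; split=> X.
  by move=> UX; have [_ [-> ?]] := filter_ex (filterI Ux UX);
    exact/principal_filterP.
by move=> /principal_filterP Xx; apply: filterS Ux => _ ->.
Qed.

(** Non-principal ultrafilters refine the filter of final segments: only finitely
many points have to be removed, one at a time. *)
Lemma nonprincipal_cvg (U : set_system posnat) :
  UltraFilter U -> nonprincipal U -> val @ U --> \oo.
Proof.
move=> UU Unp X [N _ NX]; apply: (@filterS _ U _ [set n | (N <= val n)%N]) => [n|].
  exact: NX.
elim: N {NX} => [|N IHN]; first exact: filterE.
have [N0|N0] := posnP N; first by rewrite N0; apply: filterE => n; exact: valP.
apply: filterS2 IHN (nonprincipal_notin (exist _ N N0) UU Unp) => n /= Nn nN.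
by rewrite ltn_neqAle Nn andbT; apply/eqP => eN; apply: nN; exact/val_inj.
Qed.

(** By definition of the tensor product this is an iterated limit, first along
[V] and then along [U]; the inner one replaces [g n] by its eventual value
[h n]. *)
Lemma tensor_cvg (T : topologicalType) (g : nat -> nat -> T) (h : nat -> T)
    (l : T) (U V : set_system posnat) :
  UltraFilter U -> nonprincipal U -> UltraFilter V -> nonprincipal V ->
  (forall n, \forall m \near \oo, g n m = h n) -> h n @[n --> \oo] --> l ->
  g (val nm.1) (val nm.2) @[nm --> tensor U V] --> l.
Proof.
move=> UU Unp UV Vnp gh hl X lX.
have := nonprincipal_cvg UU Unp (hl X lX).
apply: (@filterS _ U) => n /= hnX.
have := nonprincipal_cvg UV Vnp (gh (val n)).
by apply: (@filterS _ V) => m /= ->.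
Qed.

(** * Least means of an additive window function *)

Section window_sum.
Context (R : realType) (c : nat -> nat -> R) (mu : nat -> R).
Hypothesis cD : forall x k l, c x (k + l)%N = c x k + c (x + k)%N l.
Hypothesis c_bound : forall x k, `|c x k| <= k%:R.
Hypothesis muP : forall k, exists2 x, (0 < x)%N &
  mu k = c x k / k%:R /\ forall y, (0 < y)%N -> c x k / k%:R <= c y k / k%:R.

Let a k := k%:R * mu k.

Let c_div x k : k%:R * (c x k / k%:R) = c x k.
Proof.
have [->|k0] := posnP k; last by rewrite mulrC divfK// pnatr_eq0 -lt0n.
by rewrite mul0r; apply/eqP; rewrite eq_sym -normr_le0 c_bound.
Qed.

Let mu_le x k : (0 < x)%N -> a k <= c x k.
Proof.
move=> x0; rewrite /a; have [y _ [-> ymin]] := muP k.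
by rewrite -[leRHS]c_div ler_wpM2l// ymin.
Qed.

(** The best window of length [k + l] consists of two adjacent windows, neither of
which can do better than the minimum for its length. *)
Let aD k l : a k + a l <= a (k + l)%N.
Proof.
rewrite [leRHS]/a; have [x x0 [-> _]] := muP (k + l)%N.
by rewrite c_div cD lerD ?mu_le// addn_gt0 x0.
Qed.

Let a_bound n : `|a n| <= n%:R.
Proof. by rewrite /a; have [x _ [-> _]] := muP n; rewrite c_div. Qed.

Let slopeE k : a k / k%:R = mu k.
Proof.
have [->|k0] := posnP k; last by rewrite /a mulrC mulKf// pnatr_eq0 -lt0n.
by have [x _ [-> _]] := muP 0%N; rewrite !invr0 !mulr0.
Qed.

Let muE : mu = fun k => a k / k%:R.
Proof. by apply/funext => k; rewrite slopeE. Qed.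

Lemma min_mean_cvg : cvgn mu.
Proof.
by rewrite muE; apply/cvg_ex; eexists; exact: superadditive_cvg.
Qed.

(** For fixed [n], the finitely many minima [mu k] with [k <= n] are all reached
for large [m], which reduces the statement to Fekete's lemma. *)
Lemma min_mean_tensor_cvg (U V : set_system posnat) :
  UltraFilter U -> nonprincipal U -> UltraFilter V -> nonprincipal V ->
  max_upto (fun k => min_upto (fun x => c x k / k%:R) (val nm.2)) (val nm.1)
    @[nm --> tensor U V] --> limn mu.
Proof.
move=> UU Unp UV Vnp.
apply: (@tensor_cvg _ (fun n m =>
  max_upto (fun k => min_upto (fun x => c x k / k%:R) m) n) (max_upto mu)) => //.
  move=> n; have : \forall m \near \oo, forall k : 'I_n.+2,
      min_upto (fun x => c x k / k%:R) m = mu k.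
    apply: filter_forall => k; have [x x0 [-> xmin]] := muP k.
    exact: (@min_upto_near _ (fun x => c x k / k%:R)).
  apply: filterS => m mE; apply: eq_max_upto => k kn.
  exact: (mE (Ordinal (kn : (k < n.+2)%N))).
by rewrite muE (cvg_lim _ (superadditive_cvg aD a_bound))//; exact: superadditive_max_cvg.
Qed.

End window_sum.

(** * Banach densities *)

Lemma window_cardD (A : set posnat) (x k l : nat) :
  window_card A x (k + l) = (window_card A x k + window_card A (x + k) l)%N.
Proof.
rewrite /window_card.
have wfin y j : finite_set (A `&` [set z | (y.+1 <= val z <= y + j)%N]).
  apply: (@sub_finite_set _ _ (val @^-1` `I_(y + j).+1)) => [z [_ /andP[]]//|].
  by apply: finite_preimage; [move=> z t _ _; exact: val_inj|exact: finite_II].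
set B := [set y | (x.+1 <= val y <= x + k)%N].
set C := [set y | ((x + k).+1 <= val y <= x + k + l)%N].
have -> : [set y | (x.+1 <= val y <= x + (k + l))%N] = B `|` C.
  apply/seteqP; split=> y; rewrite /B /C /=; last by case; lia.
  by have [] := leqP (val y) (x + k); [left|right]; lia.
have BC0 : B `&` C = set0.
  by apply/seteqP; split=> // y; rewrite /B /C => -[/=]; lia.
rewrite setIUr (fset_setU (wfin _ _) (wfin _ _)) -cardfsUI.
rewrite -(fset_setI (wfin _ _) (wfin _ _)) -setIIr BC0.
by rewrite setI0 fset_set0 cardfs0 addn0.
Qed.

Theorem proposition4p6 (R : realType) (A : set posnat) :
  (forall U V : set_system posnat,
     UltraFilter U -> nonprincipal U -> UltraFilter V -> nonprincipal V ->
     max_upto (fun k => min_upto (fun x => window_density R A x k) (val nm.2))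
       (val nm.1) @[nm --> tensor U V] --> lower_BD R A) /\
  (forall U V : set_system posnat,
     UltraFilter U -> nonprincipal U -> UltraFilter V -> nonprincipal V ->
     min_upto (fun k => max_upto (fun x => window_density R A x k) (val nm.2))
       (val nm.1) @[nm --> tensor U V] --> upper_BD R A).
Proof.
pose c x k : R := (window_card A x k)%:R.
have cD x k l : c x (k + l)%N = c x k + c (x + k)%N l.
  by rewrite /c window_cardD natrD.
have c_bound x k : `|c x k| <= k%:R by rewrite normr_nat ler_nat window_card_le.
split=> U V UU Unp UV Vnp.
  exact: (min_mean_tensor_cvg cD c_bound (min_densityP R A)).
(* The negated counts satisfy the same hypotheses; their least means are the
   opposites of the greatest densities. *)
pose d x k := - c x k.
have dE x k : d x k / k%:R = - window_density R A x k by rewrite mulNr.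
have dD x k l : d x (k + l)%N = d x k + d (x + k)%N l by rewrite /d cD opprD.
have d_bound x k : `|d x k| <= k%:R by rewrite normrN.
have dP k : exists2 x, (0 < x)%N & - max_density R A k = d x k / k%:R /\
    forall y, (0 < y)%N -> d x k / k%:R <= d y k / k%:R.
  have [x x0 [-> xmax]] := max_densityP R A k; exists x => //.
  by rewrite dE; split=> // y y0; rewrite dE lerN2 xmax.
have upperE : upper_BD R A = - limn (fun k => - max_density R A k).
  rewrite -limN; last exact: min_mean_cvg dD d_bound dP.
  by congr (limn _); apply/funext => k /=; rewrite opprK.
rewrite upperE.
have min_max_dual : (fun nm : posnat * posnat => min_upto (fun k =>
      max_upto (fun x => window_density R A x k) (val nm.2)) (val nm.1)) =
    \- (fun nm : posnat * posnat => max_upto (fun k =>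
      min_upto (fun x => d x k / k%:R) (val nm.2)) (val nm.1)).
  apply/funext => nm; rewrite [RHS]/= -min_uptoN; congr (min_upto _ _).
  apply/funext => k; rewrite -max_uptoN; congr (max_upto _ _).
  by apply/funext => x; rewrite dE opprK.
have UVU := tensor_ultra UU UV; rewrite min_max_dual.
exact: (cvgN (min_mean_tensor_cvg dD d_bound dP UU Unp UV Vnp)).
Qed.
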